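(* Let $p$ be a prime, let $d$ be a positive integer with $d<p$, let $l\in\mathbb{N}$ and $\delta>0$. There is a constant $c(\delta,l,d,p)>0$, depending only on $\delta,l,d,p$, such that the following holds. Let $n,R\geq1$ be integers, let $A\subseteq\mathbb{F}_p^n$ be a set of density $\delta$, and let $S=P^{-1}(0)$, where $P=(P_1,\ldots,P_R):\mathbb{F}_p^n\to\mathbb{F}_p^R$ is a polynomial map whose components are homogeneous polynomials of degree $d$ over $\mathbb{F}_p$. If $$R<c(\delta,l,d,p)\,n,$$ then $A$ contains an arithmetic progression $\{x,x+y,\ldots,x+(l-1)y\}$ with common difference $y\in S\setminus\{0\}$.
   Context: The density of $A\subseteq\mathbb{F}_p^n$ is $|A|/p^n$. *)

(* Defs.v *)
From HB Require Import structures.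
From mathcomp Require Import all_boot all_order all_algebra.
From mathcomp Require Import mpoly.
From mathcomp Require Import reals.

Set Implicit Arguments.
Unset Strict Implicit.
Unset Printing Implicit Defensive.

Import GRing.Theory Num.Theory.
Local Open Scope ring_scope.

Definition density (K : realType) (p n : nat) (A : {set 'rV['F_p]_n}) : K :=
  #|A|%:R / (p ^ n)%:R.

Definition poly_map (F : fieldType) (n r : nat) (P : 'I_r -> {mpoly F[n]})
    (y : 'rV[F]_n) : 'rV[F]_r :=
  \row_j (P j).@[y 0].

(* For l = 0 the progression is empty. *)
Definition arith_prog (p n l : nat) (x y : 'rV['F_p]_n) : {set 'rV['F_p]_n} :=
  [set x + y *+ i | i : 'I_l].

(* Main.v *)
(* Since [P] is homogeneous, Chevalley-Warning applied one vector at a time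
   produces a subspace V of bounded dimension N on which every [P j] vanishes, as
   soon as n exceeds a constant (depending on N) times R.  Some translate of V
   meets A with density at least delta, and for N large the density
   Hales-Jewett theorem with alphabet 'F_p gives a combinatorial line there,
   which is a full affine line with direction in V.

   Density Hales-Jewett is proved by induction on the alphabet, along the lines
   of Polymath and of Dodos, Kanellopoulos and Tyros.  If a line-free set A over
   the alphabet S + {None} had nearly maximal density in all dimensions, the
   theorem for S would give a dense set of words whose substitutions None := s
   lie in A for all s; A misses this set, which is an intersection of sets
   D_s insensitive to swapping None and s.  So A is denser on some Boolean
   combination of the D_s.  Such a combination is, up to a small error, a disjoint
   union of large subspaces, which contradicts the maximality of the density.
   Subspaces are handled dually: a function whose average over every
   D-dimensional subspace is nonpositive has small average over the
   combination. *)
Require Import Defs.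
From HB Require Import structures.
From mathcomp Require Import all_boot all_order all_algebra.
From mathcomp Require Import finfield.
From mathcomp Require Import mpoly.
From mathcomp Require Import boolp reals.
From mathcomp Require Import ring lra zify.

Set Implicit Arguments.
Unset Strict Implicit.
Unset Printing Implicit Defensive.

Import Order.TTheory GRing.Theory Num.Theory.
Local Open Scope ring_scope.

(* Writing [(I + J)%type : finType] would insert [reverse_coercion], which blocks
   keyed matching. *)
Local Notation unitF := Datatypes_unit__canonical__fintype_Finite.
Local Notation optF := Datatypes_option__canonical__fintype_Finite.
Local Notation prodF := Datatypes_prod__canonical__fintype_Finite.
Local Notation sumF := Datatypes_sum__canonical__fintype_Finite.

(** * Averages over finite types *)

Section Average.
Variable K : archiRealFieldType.

(** Bernoulli's inequality: any [b] above [1 / (e * (1 - r))] works. *)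
Lemma exp_small (r e : K) : 0 <= r -> r < 1 -> 0 < e -> exists b, r ^+ b <= e.
Proof.
move=> r0 r1 e0.
have bern b : r ^+ b * (1 + b%:R * (1 - r)) <= 1.
  elim: b => [|b IH]; first by rewrite expr0; lra.
  apply: le_trans IH; rewrite exprSr -mulrA ler_wpM2l ?exprn_ge0 //.
  by rewrite -natr1; have := sqr_ge0 (1 - r); have := ler0n K b; nra.
have er : 0 < e * (1 - r) by rewrite mulr_gt0 //; lra.
exists (Num.bound (e * (1 - r))^-1); set b := Num.bound _.
have hb : (e * (1 - r))^-1 < b%:R by apply: archi_boundP; rewrite invr_ge0 ltW.
have {}hb : 1 < b%:R * (e * (1 - r)) by rewrite -ltr_pdivrMr // div1r.
rewrite leNgt; apply/negP => er_lt.
have := bern b; rewrite leNgt => /negP[].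
apply: (lt_le_trans hb); rewrite mulrCA.
have : 0 <= b%:R * (1 - r) by rewrite mulr_ge0 //; lra.
by have := exprn_ge0 b r0; nra.
Qed.

Definition avg (X : finType) (f : X -> K) : K := (\sum_x f x) / #|X|%:R.

Variables X Y : finType.
Implicit Types f g : X -> K.

Lemma eq_avg f g : f =1 g -> avg f = avg g.
Proof. by move=> fg; rewrite /avg (eq_bigr _ (fun x _ => fg x)). Qed.

Lemma ler_avg f g : (forall x, f x <= g x) -> avg f <= avg g.
Proof. by move=> fg; rewrite ler_wpM2r ?invr_ge0 // ler_sum. Qed.

Lemma avg_const (c : K) : (0 < #|X|)%N -> avg (fun _ : X => c) = c.
Proof.
move=> X0; rewrite /avg sumr_const -[c *+ _]mulr_natr mulfK //.
by rewrite pnatr_eq0 -lt0n.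
Qed.

Lemma avgD f g : avg (fun x => f x + g x) = avg f + avg g.
Proof. by rewrite /avg big_split mulrDl. Qed.

Lemma avgZ (c : K) f : avg (fun x => c * f x) = c * avg f.
Proof. by rewrite /avg -mulr_sumr mulrA. Qed.

Lemma avg_sum (I : finType) (P : pred I) (F : I -> X -> K) :
  avg (fun x => \sum_(i | P i) F i x) = \sum_(i | P i) avg (F i).
Proof. by rewrite /avg exchange_big /= mulr_suml. Qed.

Lemma avg_exchange (F : X -> Y -> K) :
  avg (fun x => avg (F x)) = avg (fun y => avg (F^~ y)).
Proof.
by rewrite /avg -!mulr_suml exchange_big /= -!mulrA [_^-1 / _]mulrC.
Qed.

Lemma avg_bij (h : X -> Y) (f : Y -> K) :
  bijective h -> avg (fun x => f (h x)) = avg f.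
Proof.
move=> bij_h; rewrite /avg (bij_eq_card bij_h); congr (_ / _).
by rewrite [RHS](reindex h) //; apply: onW_bij.
Qed.

Lemma avg_pair (F : X * Y -> K) : avg F = avg (fun x => avg (fun y => F (x, y))).
Proof.
rewrite /avg card_prod natrM invfM mulrA -!mulr_suml mulrAC.
by congr (_ / _ / _); rewrite pair_big /=; apply: eq_bigr => -[].
Qed.

Lemma avg_ge_ex (a : K) f : (0 < #|X|)%N -> a <= avg f -> exists x, a <= f x.
Proof.
move=> X0 af; apply/existsP; apply: contraLR af => /existsPn nle.
rewrite -ltNge -[a](avg_const a X0) /avg ltr_pM2r ?invr_gt0 ?ltr0n //.
apply: ltr_sum => [|x _]; last by rewrite ltNge.
by have /card_gt0P[x _] := X0; apply/hasP; exists x; rewrite ?mem_index_enum.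
Qed.
End Average.

(** * Words, templates and combinatorial lines *)

Lemma bij_of_card (D E : finType) : #|D| = #|E| -> exists f : D -> E, bijective f.
Proof.
move=> DE; exists (enum_val \o cast_ord DE \o enum_rank).
apply: bij_comp; first apply: bij_comp.
- exact: enum_val_bij.
- by exists (cast_ord (esym DE)) => i; rewrite ?cast_ordK ?cast_ordKV.
- exact: enum_rank_bij.
Qed.

Lemma finType_ind (Q : finType -> Prop) :
  Q void -> (forall D : finType, Q D -> Q (sumF unitF D)) ->
  (forall (D E : finType) (f : D -> E), bijective f -> Q D -> Q E) ->
  forall D, Q D.
Proof.
move=> Q0 QS Qbij D.
have [E [QE cardE]] : exists E : finType, Q E /\ #|E| = #|D|.
  elim: #|D| => [|n [E [QE cardE]]]; first by exists void; rewrite card_void.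
  by exists (sumF unitF E); rewrite card_sum card_unit cardE; split; first exact: QS.
by have [f bij_f] := bij_of_card cardE; apply: Qbij bij_f QE.
Qed.

Lemma card_word_gt0 (I T : finType) : (0 < #|T|)%N -> (0 < #|{ffun I -> T}|)%N.
Proof. by move=> T0; rewrite card_ffun expn_gt0 T0. Qed.

Definition catw (I J T : finType) (x : {ffun I -> T}) (y : {ffun J -> T}) :
    {ffun sumF I J -> T} :=
  [ffun k => match k with inl i => x i | inr j => y j end].

Section AvgWords.
Variable K : archiRealFieldType.

Lemma avg_cat (I J T : finType) (F : {ffun I + J -> T} -> K) :
  avg F = avg (fun x => avg (fun y => F (catw x y))).
Proof.
rewrite -(avg_pair (fun p => F (catw p.1 p.2))).
rewrite (avg_bij (h := fun p => catw p.1 p.2)) //.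
exists (fun z : {ffun I + J -> T} =>
  ([ffun i => z (inl i)] : {ffun I -> T}, [ffun j => z (inr j)] : {ffun J -> T})).
  by case=> x y; congr pair; apply/ffunP=> i; rewrite !ffunE.
by move=> z; apply/ffunP=> -[i|j]; rewrite !ffunE.
Qed.

Lemma avg_unit (T : finType) (F : {ffun unit -> T} -> K) :
  avg F = avg (fun t => F [ffun=> t]).
Proof.
rewrite (avg_bij (h := fun t => [ffun=> t])) //.
exists (fun z : {ffun unit -> T} => z tt) => [t|z]; first by rewrite ffunE.
by apply/ffunP=> -[]; rewrite ffunE.
Qed.

Lemma avg_void (T : finType) (F : {ffun void -> T} -> K) z : avg F = F z.
Proof.
rewrite -[RHS](avg_const (X := {ffun void -> T})) ?card_ffun ?card_void //.
by apply: eq_avg => y; congr F; apply/ffunP=> -[].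
Qed.

Lemma avg_relabel (D E T : finType) (f : D -> E) (F : {ffun D -> T} -> K) :
  bijective f -> avg (fun u : {ffun E -> T} => F [ffun d => u (f d)]) = avg F.
Proof.
case=> g fK gK; rewrite (avg_bij (h := fun u : {ffun E -> T} => [ffun d => u (f d)])) //.
exists (fun v : {ffun D -> T} => [ffun e => v (g e)] : {ffun E -> T}) => u; apply/ffunP=> i.
  by rewrite !ffunE gK.
by rewrite !ffunE fK.
Qed.
End AvgWords.

Section Templates.
Variable T : finType.
Implicit Types I J D E : finType.

(** A template is a word with wildcards indexed by [D]: a parametrised combinatorial subspace,
    injectively parametrised when [full]. *)
Definition app I D (tau : I -> T + D) (u : {ffun D -> T}) : {ffun I -> T} :=
  [ffun i => match tau i with inl t => t | inr j => u j end].

Definition full I D (tau : I -> T + D) := forall j, exists i, tau i = inr j.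

Definition comp_tpl I D E (tau : I -> T + D) (sigma : D -> T + E) (i : I) : T + E :=
  match tau i with inl t => inl t | inr j => sigma j end.

Lemma app_comp I D E (tau : I -> T + D) (sigma : D -> T + E) u :
  app (comp_tpl tau sigma) u = app tau (app sigma u).
Proof.
by apply/ffunP=> i; rewrite !ffunE /comp_tpl; case: (tau i) => // j; rewrite ffunE.
Qed.

Lemma full_comp I D E (tau : I -> T + D) (sigma : D -> T + E) :
  full tau -> full sigma -> full (comp_tpl tau sigma).
Proof.
move=> ft fs e; have [d sd] := fs e; have [i ti] := ft d.
by exists i; rewrite /comp_tpl ti.
Qed.

Lemma app_inj I D (tau : I -> T + D) : full tau -> injective (app tau).
Proof.
move=> ft u v /ffunP uv; apply/ffunP=> j; have [i ti] := ft j.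
by have := uv i; rewrite !ffunE ti.
Qed.

Definition tpl_inr I J (x : {ffun I -> T}) (k : I + J) : T + J :=
  match k with inl i => inl (x i) | inr j => inr j end.

Definition tpl_inl I J (y : {ffun J -> T}) (k : I + J) : T + I :=
  match k with inl i => inr i | inr j => inl (y j) end.

Lemma app_inr I J (x : {ffun I -> T}) (y : {ffun J -> T}) :
  app (tpl_inr x) y = catw x y.
Proof. by apply/ffunP=> -[i|j]; rewrite !ffunE. Qed.

Lemma app_inl I J (x : {ffun I -> T}) (y : {ffun J -> T}) :
  app (tpl_inl y) x = catw x y.
Proof. by apply/ffunP=> -[i|j]; rewrite !ffunE. Qed.

Lemma full_inr I J (x : {ffun I -> T}) : full (@tpl_inr I J x).
Proof. by move=> j; exists (inr j). Qed.

Lemma full_inl I J (y : {ffun J -> T}) : full (@tpl_inl I J y).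
Proof. by move=> i; exists (inl i). Qed.

Definition tpl_relabel I D E (f : D -> E) (tau : I -> T + D) (i : I) : T + E :=
  match tau i with inl t => inl t | inr j => inr (f j) end.

Lemma app_relabel I D E (f : D -> E) (tau : I -> T + D) u :
  app (tpl_relabel f tau) u = app tau [ffun d => u (f d)].
Proof.
by apply/ffunP=> i; rewrite !ffunE /tpl_relabel; case: (tau i) => // j; rewrite ffunE.
Qed.

Lemma full_relabel I D E (f : D -> E) (tau : I -> T + D) :
  bijective f -> full tau -> full (tpl_relabel f tau).
Proof.
case=> g fK gK ft e; have [i ti] := ft (g e).
by exists i; rewrite /tpl_relabel ti gK.
Qed.

Definition tpl_sum I J D E (tau : I -> T + D) (sigma : J -> T + E) (k : I + J) :
    T + (D + E) :=
  match k with
  | inl i => match tau i with inl t => inl t | inr d => inr (inl d) end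
  | inr j => match sigma j with inl t => inl t | inr e => inr (inr e) end
  end.

Lemma app_sum I J D E (tau : I -> T + D) (sigma : J -> T + E) u v :
  app (tpl_sum tau sigma) (catw u v) = catw (app tau u) (app sigma v).
Proof.
apply/ffunP=> -[i|j]; rewrite !ffunE /=.
  by case: (tau i) => // d; rewrite ffunE.
by case: (sigma j) => // d; rewrite ffunE.
Qed.

Lemma catwP I J (z : {ffun I + J -> T}) : exists x y, z = catw x y.
Proof.
exists [ffun i => z (inl i)], [ffun j => z (inr j)].
by apply/ffunP=> -[i|j]; rewrite !ffunE.
Qed.

Lemma full_sum I J D E (tau : I -> T + D) (sigma : J -> T + E) :
  full tau -> full sigma -> full (tpl_sum tau sigma).
Proof.
move=> ft fs [d|e].
  by have [i ti] := ft d; exists (inl i); rewrite /= ti.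
by have [i ti] := fs e; exists (inr i); rewrite /= ti.
Qed.

(* A combinatorial line over [T] is a word over [option T] in which the
   wildcard [None] occurs. *)
Definition lsub I (w : {ffun I -> option T}) (t : T) : {ffun I -> T} :=
  [ffun i => odflt t (w i)].

Definition has_line I (A : pred {ffun I -> T}) :=
  exists w : {ffun I -> option T}, (exists i, w i = None) /\ forall t, A (lsub w t).

Lemma has_line_app I D (tau : I -> T + D) (A : pred {ffun I -> T}) :
  full tau -> has_line (fun u => A (app tau u)) -> has_line A.
Proof.
move=> ft [w [[j wj] Aw]].
exists [ffun i => match tau i with inl t => Some t | inr j => w j end]; split.
  by have [i ti] := ft j; exists i; rewrite ffunE ti.
move=> t; rewrite (_ : lsub _ t = app tau (lsub w t)) //.
by apply/ffunP=> i; rewrite !ffunE; case: (tau i) => // d; rewrite !ffunE.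
Qed.
End Templates.

(** * The density Hales-Jewett property and its multidimensional form *)

Section DHJ.
Variable K : archiRealFieldType.

Definition dens (X : finType) (A : pred X) : K := avg (fun x => (A x)%:R).

Lemma dens_le1 (X : finType) (A : pred X) : dens A <= 1.
Proof.
have [X0|] := posnP #|X|.
  by rewrite /dens /avg X0 invr0 mulr0.
by move=> X0; rewrite -(avg_const 1 X0); apply: ler_avg => x; rewrite lern1 leq_b1.
Qed.

Lemma dens_catl (I J T : finType) (A : pred {ffun I + J -> T}) :
  dens A = avg (fun x => dens (fun y => A (catw x y))).
Proof. exact: avg_cat. Qed.

Lemma dens_catr (I J T : finType) (A : pred {ffun I + J -> T}) :
  dens A = avg (fun y => dens (fun x => A (catw x y))).
Proof. rewrite dens_catl; exact: avg_exchange. Qed.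

Definition DHJ (T : finType) := forall delta : K, 0 < delta ->
  exists I : finType, forall A : pred {ffun I -> T}, delta <= dens A -> has_line A.

(* Markov's inequality followed by a pigeonhole over the finitely many lines. *)
Lemma line_pigeonhole (X I T : finType) (c : K) (A : X -> pred {ffun I -> T}) :
  (0 < #|X|)%N -> 0 < c -> 
  (forall B : pred {ffun I -> T}, c <= dens B -> has_line B) ->
  2 * c <= avg (fun x => dens (A x)) ->
  exists w : {ffun I -> option T}, (exists i, w i = None) /\
    c / #|{ffun I -> option T}|%:R <= dens (fun x => [forall t, A x (lsub w t)]).
Proof.
move=> X0 c0 hl hA.
have h1 : c <= dens (fun x => c <= dens (A x)).
  suff : 2 * c <= c + dens (fun x => c <= dens (A x)) by lra.
  apply: le_trans hA _; rewrite -{1}(avg_const c X0) /dens -avgD.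
  apply: ler_avg => x; case: (lerP c (dens (A x))) => h /=.
    by have := dens_le1 (A x); rewrite /dens; lra.
  by rewrite addr0 ltW.
pose P (w : {ffun I -> option T}) := [exists i, w i == None].
have W0 : (0 < #|{ffun I -> option T}|)%N by rewrite card_word_gt0 // card_option.
suff [w Pw] : exists w, c <= (P w)%:R * dens (fun x => [forall t, A x (lsub w t)])
                * #|{ffun I -> option T}|%:R.
  exists w; case: (boolP (P w)) Pw => [/existsP[i /eqP wi]|_].
    by rewrite mul1r => h; split; [exists i | rewrite ler_pdivrMr ?ltr0n].
  by rewrite !mul0r => /(lt_le_trans c0); rewrite ltxx.
apply: avg_ge_ex => //; rewrite /avg -mulr_suml mulfK ?pnatr_eq0 -?lt0n //.
apply: le_trans h1 _.
under eq_bigr => w _ do rewrite -avgZ.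
rewrite -avg_sum; apply: ler_avg => x.
case: (lerP c) => [/hl [w [[i wi] Aw]]|_]; last first.
  by apply: sumr_ge0 => w _; rewrite mulr_ge0.
rewrite (bigD1 w) //= [P w](_ : _ = true); last by apply/existsP; exists i; rewrite wi.
rewrite [[forall t, _]](_ : _ = true) ?mulr1 ?lerDl ?sumr_ge0 //.
  by move=> v _; rewrite mulr_ge0.
by apply/forallP.
Qed.

Definition tpl_of_line (I T : finType) (w : {ffun I -> option T}) (i : I) : T + unit :=
  if w i is Some t then inl t else inr tt.

(** For a positive proportion of the words on [J], the same line of the block [I] lies in [A]; it
    supplies one wildcard, and induction on those words supplies the others. *)
Lemma MDHJ (T : finType) : (0 < #|T|)%N -> DHJ T ->
  forall (D : finType) (delta : K), 0 < delta ->
  exists I : finType, forall A : pred {ffun I -> T}, delta <= dens A ->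
  exists tau : I -> T + D, full tau /\ forall u, A (app tau u).
Proof.
move=> T0 dhj; elim/finType_ind => [|D IH|D E f bij_f IH] delta d0.
- exists void => A dA.
  pose tau (i : void) : T + void := match i with end.
  exists tau; split=> [[]|u]; move: dA; rewrite /dens (avg_void _ (app tau u)).
  by case: (A _) => // /(lt_le_trans d0); rewrite ltxx.
- have d20 : 0 < delta / 2 by lra.
  have [I hI] := dhj _ d20.
  have W0 : (0 < #|{ffun I -> option T}|)%N by rewrite card_word_gt0 // card_option.
  have [|J hJ] := IH (delta / 2 / #|{ffun I -> option T}|%:R).
    by rewrite divr_gt0 ?ltr0n.
  exists (sumF I J) => A dA.
  have dA' : 2 * (delta / 2) <= avg (fun y => dens (fun x => A (catw x y))).
    by rewrite -dens_catr; lra.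
  have [w [[i wi] /hJ [tau [ft At]]]] :=
    line_pigeonhole (card_word_gt0 J T0) d20 hI dA'.
  exists (tpl_sum (tpl_of_line w) tau); split.
    by apply: full_sum => // -[]; exists i; rewrite /tpl_of_line wi.
  move=> u; have [x [y ->]] := catwP u; rewrite app_sum.
  have /forallP/(_ (x tt)) := At y; congr (A (catw _ _)).
  by apply/ffunP=> k; rewrite !ffunE /tpl_of_line; case: (w k).
- have [I hI] := IH delta d0; exists I => A /hI [tau [ft At]].
  exists (tpl_relabel f tau); split; first exact: full_relabel.
  by move=> u; rewrite app_relabel.
Qed.
End DHJ.

(** * Random templates *)

Section Free.
Variable K : archiRealFieldType.

(** With probability [#|T|%:R / #|L|%:R] a uniform letter of [L] lies in the image of [q], and [p]
    then makes it uniform on [T]; elsewhere only [m] bounds [H]. *)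
Lemma avg_section (L T : finType) (p : L -> T) (q : T -> L) (H : T -> K) (a m : K) :
  (0 < #|T|)%N -> cancel q p -> (forall t, H t <= m) -> avg H <= a ->
  avg (fun c => H (p c)) <= a + (1 - #|T|%:R / #|L|%:R) * (m - a).
Proof.
move=> T0 qK Hm Ha.
have L0 : (0 < #|L|)%N by apply: leq_trans T0 _; apply: leq_card (can_inj qK).
have L0' : 0 < #|L|%:R :> K by rewrite ltr0n.
have T0' : 0 < #|T|%:R :> K by rewrite ltr0n.
suff h : #|T|%:R * (m - a) <= #|L|%:R * (m - avg (fun c => H (p c))).
  rewrite (_ : _ + _ = m - #|T|%:R * (m - a) / #|L|%:R); last by field; apply: lt0r_neq0.
  by rewrite lerBrDr -lerBrDl ler_pdivrMr // [X in _ <= X]mulrC.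
have sumE (X : finType) (f : X -> K) : (0 < #|X|)%N ->
    #|X|%:R * (m - avg f) = \sum_x (m - f x).
  move=> X0; rewrite mulrBr /avg mulrC [_ * (_ / _)]mulrC divfK ?pnatr_eq0 -?lt0n //.
  by rewrite sumrB sumr_const mulr_natr.
apply: (@le_trans _ _ (#|T|%:R * (m - avg H))).
  by rewrite ler_pM2l // lerD2l lerN2.
rewrite !sumE // (bigID (mem [set q t | t : T])) /= big_imset /=; last first.
  by move=> t t' _ _; apply: can_inj qK _ _.
under [X in _ <= X + _]eq_bigr do rewrite qK.
by rewrite lerDl sumr_ge0 // => c _; rewrite subr_ge0.
Qed.

Fixpoint copies (X : finType) (b : nat) : finType :=
  if b is b'.+1 then sumF X (copies X b') else void.

Lemma map_catw (I J L T : finType) (p : L -> T) (x : {ffun I -> L}) (y : {ffun J -> L}) :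
  [ffun i => p (catw x y i)] = catw [ffun i => p (x i)] [ffun j => p (y j)].
Proof. by apply/ffunP=> -[i|j]; rewrite !ffunE. Qed.

Lemma avg_le_const (X : finType) (f : X -> K) (a : K) :
  (0 < #|X|)%N -> (forall x, f x <= a) -> avg f <= a.
Proof. by move=> X0 fa; rewrite -(avg_const a X0); apply: ler_avg. Qed.

(** The wildcard is the first letter in the image of [q]; the power with exponent [b] is the
    probability that there is none, where [g <= 1] is used. *)
Lemma free_wildcard (L T : finType) (p : L -> T) (q : T -> L) (b : nat) :
  (0 < #|T|)%N -> cancel q p -> forall (a : K) (g : {ffun copies unitF b -> T} -> K),
  0 <= a -> (forall z, g z <= 1) ->
  (forall tau : copies unitF b -> T + unitF, full tau -> avg (fun u => g (app tau u)) <= a) ->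
  avg (fun l : {ffun copies unitF b -> L} => g [ffun i => p (l i)])
    <= a + (1 - #|T|%:R / #|L|%:R) ^+ b.
Proof.
move=> T0 qK.
have L0 : (0 < #|L|)%N by apply: leq_trans T0 _; apply: leq_card (can_inj qK).
elim: b => [|b IH] a g a0 g1 ga /=.
  rewrite expr0; apply: avg_le_const => [|l]; first exact: card_word_gt0.
  by apply: le_trans (g1 _) _; rewrite lerDr.
rewrite avg_cat avg_unit.
pose H t := avg (fun v : {ffun copies unitF b -> L} =>
  g (catw [ffun=> t] [ffun i => p (v i)])).
rewrite (eq_avg (g := fun c => H (p c))); last first.
  move=> c; apply: eq_avg => v; congr g; rewrite map_catw; congr catw.
  by apply/ffunP=> i; rewrite !ffunE.
pose r : K := 1 - #|T|%:R / #|L|%:R.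
rewrite exprS -[X in _ <= _ + _ * X](addKr a) [- a + _]addrC.
apply: (avg_section T0 qK).
  move=> t; apply: (IH a (fun z => g (catw [ffun=> t] z))) => // tau ft.
  have := ga (comp_tpl (tpl_inr [ffun=> t]) tau) (full_comp (full_inr _) ft).
  by apply: le_trans; apply: ler_avg => u; rewrite app_comp app_inr.
rewrite /H avg_exchange; apply: avg_le_const => [|v]; first exact: card_word_gt0.
have := ga _ (full_inl [ffun i => p (v i)]); apply: le_trans.
by rewrite avg_unit; apply: ler_avg => t; rewrite app_inl.
Qed.

(* In a random word over [L], the letters chosen in the image of a section of
   [p : L -> T] form a uniformly random word over [T] once their positions and
   the other letters are fixed. *)
Lemma free_template (L T D : finType) (e : K) :
  (0 < #|T|)%N -> (0 < #|L|)%N -> 0 < e ->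
  exists J : finType, forall (p : L -> T) (q : T -> L), cancel q p ->
  forall (a : K) (g : {ffun J -> T} -> K), 0 <= a -> (forall z, g z <= 1) ->
  (forall tau : J -> T + D, full tau -> avg (fun u => g (app tau u)) <= a) ->
  avg (fun l : {ffun J -> L} => g [ffun i => p (l i)]) <= a + e.
Proof.
move=> T0 L0; elim/finType_ind: D e => [|D IH|D E f bij_f IH] e e0.
- exists void => p q qK a g a0 g1 ga; apply: avg_le_const => [|l].
    exact: card_word_gt0.
  pose tau (i : void) : T + void := match i with end.
  have ft : full tau by case.
  apply: le_trans (_ : a <= _); last by rewrite lerDl ltW.
  apply: le_trans (ga tau ft); rewrite (avg_void _ [ffun i : void => match i with end]).
  by rewrite (_ : app _ _ = [ffun i => p (l i)]) //; apply/ffunP=> -[].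
- have [|J hJ] := IH (e / 2); first by lra.
  have [b hb] : exists b, (1 - #|T|%:R / #|L|%:R) ^+ b <= e / 2 \/
      (#|L| < #|T|)%N.
    have [LT|TL] := ltnP #|L| #|T|; first by exists 0; right.
    have [|||b hb] := @exp_small K (1 - #|T|%:R / #|L|%:R) (e / 2); last first.
    + by exists b; left.
    + by lra.
    + by rewrite ltrBlDr ltrDl divr_gt0 ?ltr0n.
    by rewrite subr_ge0 ler_pdivrMr ?ltr0n // mul1r ler_nat.
  exists (sumF (copies unitF b) J) => p q qK a g a0 g1 ga.
  case: hb => [hb|]; last by rewrite ltnNge (leq_card _ (can_inj qK)).
  apply: (@le_trans _ _ (a + e / 2 + (1 - #|T|%:R / #|L|%:R) ^+ b)); last by lra.
  rewrite avg_cat.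
  pose g1' (x : {ffun copies unitF b -> T}) :=
    avg (fun v : {ffun J -> L} => g (catw x [ffun i => p (v i)])).
  rewrite (eq_avg (g := fun l : {ffun copies unitF b -> L} => g1' [ffun i => p (l i)])); last first.
    by move=> l; apply: eq_avg => v; rewrite map_catw.
  apply: (free_wildcard T0 qK) => [|x|sigma fs]; first by lra.
    by apply: avg_le_const => //; exact: card_word_gt0.
  rewrite /g1' avg_exchange.
  apply: (hJ p q qK a (fun z => avg (fun t => g (catw (app sigma t) z)))) => // [z|tau ft].
    by apply: avg_le_const => //; exact: card_word_gt0.
  rewrite avg_exchange; apply: le_trans (ga _ (full_sum fs ft)).
  by rewrite avg_cat; apply: ler_avg => t; apply: ler_avg => u; rewrite app_sum.
- have [J hJ] := IH e e0; exists J => p q qK a g a0 g1 ga.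
  apply: (hJ p q qK) => // tau ft.
  apply: le_trans (ga _ (full_relabel bij_f ft)).
  rewrite -(avg_relabel (fun u => g (app tau u)) bij_f).
  by apply: ler_avg => u; rewrite app_relabel.
Qed.
End Free.

(** * Insensitive sets *)

Section Insensitive.
Variable S : finType.
Implicit Types (I J D : finType) (s : S).

Definition fill I s (x : {ffun I -> option S}) : {ffun I -> option S} :=
  [ffun i => Some (odflt s (x i))].

(** Equivalently, exchanging [s] and [None] at any positions preserves membership: [fill s x] is a
    normal form. *)
Definition insens I s (E : pred {ffun I -> option S}) :=
  forall x, E (fill s x) = E x.

Lemma fillK I s (x : {ffun I -> option S}) : fill s (fill s x) = fill s x.
Proof. by apply/ffunP=> i; rewrite !ffunE. Qed.

Lemma fill_catw I J s (x : {ffun I -> option S}) (y : {ffun J -> option S}) :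
  fill s (catw x y) = catw (fill s x) (fill s y).
Proof. by apply/ffunP=> -[i|j]; rewrite !ffunE. Qed.

Lemma insens_app I D s (E : pred {ffun I -> option S}) (tau : I -> option S + D) :
  insens s E -> insens s (fun u => E (app tau u)).
Proof.
move=> iE u; rewrite -iE -[RHS]iE; congr E; apply/ffunP=> i; rewrite !ffunE.
by case: (tau i) => // j; rewrite ffunE.
Qed.

Lemma insens_catl I J s (E : pred {ffun I + J -> option S}) y :
  insens s E -> insens s (fun x => E (catw x y)).
Proof.
by move=> iE x; rewrite -iE -[RHS]iE !fill_catw fillK.
Qed.

Lemma insens_catr I J s (E : pred {ffun I + J -> option S}) x :
  insens s E -> insens s (fun y => E (catw x y)).
Proof.
by move=> iE y; rewrite -iE -[RHS]iE !fill_catw fillK.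
Qed.

Lemma insens_fill I J s (E : pred {ffun I + J -> option S}) x y :
  insens s E -> E (catw x (fill s y)) = E (catw x y).
Proof. by move=> /(insens_catr x)/(_ y). Qed.

Definition tpl_some I D (tau : I -> S + D) (i : I) : option S + D :=
  match tau i with inl t => inl (Some t) | inr j => inr j end.

Lemma full_some I D (tau : I -> S + D) : full tau -> full (tpl_some tau).
Proof. by move=> ft j; have [i ti] := ft j; exists i; rewrite /tpl_some ti. Qed.

Lemma fill_app_some I D s (tau : I -> S + D) (u : {ffun D -> option S}) :
  fill s (app (tpl_some tau) u) =
  [ffun i => Some (app tau [ffun d => odflt s (u d)] i)].
Proof.
by apply/ffunP=> i; rewrite !ffunE /tpl_some; case: (tau i) => // d; rewrite ffunE.
Qed.
End Insensitive.

(** * Insensitive sets: large subspaces and Boolean combinations *)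

Section Partition.
Variables (K : archiRealFieldType) (S : finType).
Hypotheses (dhj : DHJ K S).
Implicit Types (I J D : finType) (s : S).

(** An insensitive set is determined by its words over [S]. These are dense on some template by
    [free_template], [MDHJ] finds a subspace there, and insensitivity admits the letter [None] in
    it. *)
Lemma insens_subspace D (k : K) : (0 < #|S|)%N -> 0 < k ->
  exists Q : finType, forall s (E : pred {ffun Q -> option S}), insens s E ->
  k <= dens K E ->
  exists tau : Q -> option S + D, full tau /\ forall u, E (app tau u).
Proof.
move=> S0 k0.
have [M hM] := MDHJ S0 dhj D (ltac:(lra) : 0 < k / 2).
have SO0 : (0 < #|{: option S}|)%N by rewrite card_option.
have [Q hQ] := @free_template K (option S) S M (k / 4) S0 SO0 ltac:(lra).
exists Q => s E iE kE.
pose E' (y : {ffun Q -> S}) := E [ffun i => Some (y i)].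
have [[tau [ft Et]]|no] := pselect (exists tau : Q -> S + M, full tau /\
    k / 2 <= dens K (fun u => E' (app tau u))).
  have [sigma [fs Es]] := hM _ Et.
  exists (tpl_some (comp_tpl tau sigma)); split.
    exact/full_some/full_comp.
  by move=> u; rewrite -iE fill_app_some app_comp; apply: Es.
suff : dens K E <= k / 2 + k / 4 by lra.
rewrite /dens (eq_avg (g := fun l : {ffun Q -> option S} =>
  (fun y => (E' y)%:R : K) [ffun i => odflt s (l i)])); last first.
  by move=> l; rewrite /E' -iE; congr (_ (E _))%:R; apply/ffunP=> i; rewrite !ffunE.
apply: (hQ (odflt s) Some _ _ (fun y => (E' y)%:R)) => [||z|tau ft]; first by [].
- by lra.
- by rewrite lern1 leq_b1.
rewrite leNgt; apply/negP => lt_avg; apply: no; exists tau; split=> //.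
exact: ltW.
Qed.

(* Greedy exhaustion: write words as [catw x y] with [x] in the block [Q].  When the
   section of [E] at [y] is dense, it contains a subspace, which is removed; the
   subspace is chosen as a function of the section alone, so that what remains of
   [E] is still insensitive in [y].  Each block multiplies the excess of the
   density over [k / 2] by at most [1 - be]. *)
Lemma insens_partition D (k : K) : (0 < #|S|)%N -> 0 < k ->
  exists N : finType, forall s (E : pred {ffun N -> option S}), insens s E ->
  forall g : {ffun N -> option S} -> K, (forall x, g x <= 1) ->
  (forall tau : N -> option S + D, full tau -> avg (fun u => g (app tau u)) <= 0) ->
  avg (fun x => (E x)%:R * g x) <= k.
Proof.
move=> S0 k0; have k20 : 0 < k / 2 by lra.
have [Q hQ] := insens_subspace D S0 k20.
have W0 I : (0 < #|{ffun I -> option S}|)%N by rewrite card_word_gt0 // card_option.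
(* The density of one word of the block [Q]: the least loss when a nonempty set is removed. *)
pose be : K := #|{ffun Q -> option S}|%:R^-1.
have be0 : 0 < be by rewrite invr_gt0 ltr0n.
have be1 : be <= 1 by rewrite invf_le1 ?ltr0n // ler1n.
have [b hb] := @exp_small K (1 - be) (k / 2) ltac:(lra) ltac:(lra) k20.
exists (copies Q b) => s E iE g g1 g0.
suff : avg (fun x => (E x)%:R * g x) <= k / 2 + (1 - be) ^+ b * (dens K E - k / 2).
  have := dens_le1 K E; have : 0 <= (1 - be) ^+ b by rewrite exprn_ge0 //; lra.
  by nra.
clear hb; elim: b => [|b IH] in E iE g g1 g0 *.
  rewrite expr0 mul1r addrC subrK; apply: ler_avg => x.
  by case: (E x); rewrite ?mul1r ?mul0r.
(* [V] is the piece removed from [F]: a subspace, or empty when [F] is sparse or not insensitive.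
   Its shape enters only through the sign of sums over it. *)
pose P (F V : {set {ffun Q -> option S}}) := [/\ V \subset F,
  forall h : {ffun Q -> option S} -> K,
    (forall tau : Q -> option S + D, full tau -> avg (fun u => h (app tau u)) <= 0) ->
    \sum_(x in V) h x <= 0 &
  insens s (mem F) -> k / 2 <= dens K (mem F) -> (0 < #|V|)%N].
have [V PV] : exists V, forall F, P F (V F).
  apply: fin_all_exists => F.
  have [[iF dF]|no] := pselect (insens s (mem F) /\ k / 2 <= dens K (mem F)); last first.
    exists set0; split=> [|h _|iF dF]; first exact: sub0set.
      by rewrite big_set0.
    by case: no.
  have [tau [ft Ft]] := hQ s _ iF dF.
  exists [set app tau u | u : {ffun D -> option S}]; split.
  - by apply/subsetP => _ /imsetP[u _ ->]; apply: Ft.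
  - move=> h /(_ tau ft); rewrite big_imset /= => [|u v _ _]; last exact: app_inj.
    by rewrite /avg ler_pdivrMr ?ltr0n // mul0r.
  - move=> _ _; have /card_gt0P[u _] := W0 D; apply/card_gt0P; exists (app tau u).
    exact: imset_f.
pose Es y := [set x | E (catw x y)].
pose R x y := E (catw x y) && (x \notin V (Es y)).
have split_avg : avg (fun z => (E z)%:R * g z) <=
    avg (fun x => avg (fun y => (R x y)%:R * g (catw x y))).
  rewrite avg_cat -[X in _ <= X]add0r.
  have -> : avg (fun x => avg (fun y => (E (catw x y))%:R * g (catw x y))) =
     avg (fun y => avg (fun x => (x \in V (Es y))%:R * g (catw x y))) +
     avg (fun x => avg (fun y => (R x y)%:R * g (catw x y))).
    rewrite [in X in _ = X + _]avg_exchange -avgD; apply: eq_avg => x.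
    rewrite -avgD; apply: eq_avg => y; rewrite -mulrDl -natrD /R.
    have [/subsetP sub _ _] := PV (Es y).
    case: (boolP (x \in V _)) => [/sub|]; last by rewrite andbT.
    by rewrite inE => ->.
  rewrite lerD2r; apply: avg_le_const => [//|y].
  have [_ Vle0 _] := PV (Es y).
  rewrite /avg ler_pdivrMr ?ltr0n ?W0 // mul0r.
  rewrite (eq_bigr (fun x => if x \in V (Es y) then g (catw x y) else 0)); last first.
    by move=> x _; case: ifP => _; rewrite ?mul1r ?mul0r.
  rewrite -big_mkcond; apply: Vle0 => tau ft.
  apply: le_trans (g0 _ (full_comp (full_inl y) ft)); apply: ler_avg => u.
  by rewrite app_comp app_inl.
apply: le_trans split_avg _.
have Es_fill y : Es (fill s y) = Es y.
  by apply/setP => x; rewrite !inE insens_fill.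
apply: (@le_trans _ _ (avg (fun x => k / 2 + (1 - be) ^+ b * (dens K (R x) - k / 2)))).
  apply: ler_avg => x; apply: IH => [y||tau ft].
  - by rewrite /R Es_fill insens_fill.
  - by move=> y.
  apply: le_trans (g0 _ (full_comp (full_inr x) ft)); apply: ler_avg => u.
  by rewrite app_comp app_inr.
rewrite avgD avg_const // avgZ avgD avg_const // lerD2l exprSr -mulrA.
rewrite ler_wpM2l ?exprn_ge0 //; first by lra.
suff : avg (fun x => dens K (R x)) <= dens K E - be * (dens K E - k / 2) by lra.
have dE : dens K E = avg (fun y => dens K (mem (Es y))).
  by rewrite dens_catr; apply: eq_avg => y; apply: eq_avg => x; rewrite !inE.
have -> : dens K E - be * (dens K E - k / 2) =
    avg (fun y => (1 - be) * dens K (mem (Es y)) + be * (k / 2)).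
  by rewrite avgD avg_const // avgZ -dE; ring.
rewrite [X in X <= _]avg_exchange.
apply: ler_avg => y.
have [sub _ V0] := PV (Es y).
have -> : avg (fun x => (R x y)%:R) = dens K (mem (Es y)) - be * #|V (Es y)|%:R.
  rewrite /dens /avg mulrC [_ / _]mulrC -mulrBr; congr (_ * _).
  rewrite -sum1_card natr_sum [X in _ = _ - X]big_mkcond -sumrB; apply: eq_bigr => x _.
  rewrite /R (_ : mem (Es y) x = E (catw x y)); last by rewrite !inE.
  have := subsetP sub x; rewrite inE.
  by case: (x \in V _) => [/(_ isT) ->|_]; rewrite ?andbT ?subrr ?subr0.
have iEs : insens s (mem (Es y)).
  by move=> x; rewrite /= !inE; apply: insens_catl iE x.
have := dens_le1 K (mem (Es y)).
(* A dense section loses a word, of weight [be], and need lose no more; a sparse one need lose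
   nothing. *)
have [/(V0 iEs) Vgt0 d1|dlt _] := lerP (k / 2) (dens K (mem (Es y))).
  have : 1 <= #|V (Es y)|%:R :> K by rewrite ler1n.
  by nra.
have : 0 <= #|V (Es y)|%:R :> K by rewrite ler0n.
by nra.
Qed.

(** Both [E s] and its complement are insensitive, hence nearly unions of subspaces of a dimension
    [D1] in which induction treats the other letters; [phi] encodes the Boolean combination. *)
Lemma insens_boolean D (k : K) (r : seq S) : (0 < #|S|)%N -> 0 < k ->
  exists N : finType, forall E : S -> pred {ffun N -> option S},
  (forall s, insens s (E s)) ->
  forall (phi : pred {set S}) (g : {ffun N -> option S} -> K), (forall x, g x <= 1) ->
  (forall tau : N -> option S + D, full tau -> avg (fun u => g (app tau u)) <= 0) ->
  avg (fun x => (phi [set s in r | E s x])%:R * g x) <= k.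
Proof.
move=> S0; elim: r k => [|s r IH] k k0.
  exists D => E iE phi g g1 g0.
  have ft : full (inr : D -> option S + D) by move=> j; exists j.
  apply: le_trans (ltW k0).
  rewrite (eq_avg (g := fun x => (phi set0)%:R * g (app inr x))).
    by rewrite avgZ mulr_ge0_le0 // g0.
  by move=> x; congr (_ * g _); apply/ffunP=> i; rewrite ffunE.
have [D1 hD1] := IH (k / 2) ltac:(lra).
have [N hN] := insens_partition D1 S0 (ltac:(lra) : 0 < k / 4).
exists N => E iE phi g g1 g0.
pose f (psi : pred {set S}) x := (psi [set t in r | E t x])%:R * g x.
(* By induction [f psi] exceeds [k / 2] on average on no subspace of dimension [D1]; the two halves
   together cost [k / 2 + 2 * (k / 4)]. *)
have fk (F : pred {ffun N -> option S}) psi : insens s F ->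
    avg (fun x => (F x)%:R * f psi x) <= k / 2 * dens K F + k / 4.
  move=> iF; rewrite -lerBlDl -avgZ -[X in _ - X]mul1r -mulNr -avgZ -avgD.
  rewrite (eq_avg (g := fun x => (F x)%:R * (f psi x - k / 2))); last first.
    by move=> x; ring.
  apply: hN iF _ _ _ => [x|tau ft].
    have : f psi x <= 1 by rewrite /f; case: (psi _); rewrite ?mul1r ?mul0r.
    by lra.
  rewrite avgD avg_const ?card_word_gt0 ?card_option // subr_le0.
  apply: (hD1 (fun t u => E t (app tau u))) => [t||sigma fs].
  - exact: insens_app.
  - by move=> u; apply: g1.
  apply: le_trans (g0 _ (full_comp ft fs)); apply: ler_avg => u.
  by rewrite app_comp.
have iEC : insens s (fun x => ~~ E s x) by move=> x; rewrite iE.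
have := fk _ (fun Y => phi (s |: Y)) (iE s).
have := fk _ (fun Y => phi (Y :\ s)) iEC.
suff -> : avg (fun x => (phi [set t in s :: r | E t x])%:R * g x) =
    avg (fun x => (E s x)%:R * f (fun Y => phi (s |: Y)) x) +
    avg (fun x => (~~ E s x)%:R * f (fun Y => phi (Y :\ s)) x).
  have : dens K (E s) + dens K (fun x => ~~ E s x) = 1.
    rewrite /dens -avgD -[RHS](avg_const (X := {ffun N -> option S})).
      by apply: eq_avg => x; case: (E s x); rewrite ?addr0 ?add0r.
    by rewrite card_word_gt0 ?card_option.
  by nra.
rewrite -avgD; apply: eq_avg => x; rewrite /f.
case: (boolP (E s x)) => Ex; rewrite ?mul1r ?mul0r ?addr0 ?add0r.
  congr (_%:R * _); congr (nat_of_bool (phi _)); apply/setP => t; rewrite !inE.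
  by have [->|] := eqVneq t s.
congr (_%:R * _); congr (nat_of_bool (phi _)); apply/setP => t; rewrite !inE.
by have [->|//] := eqVneq t s; rewrite (negbTE Ex).
Qed.
End Partition.

(** * Density Hales-Jewett *)

Section Increment.
Variable K : archiRealFieldType.

Definition line_free_dense (T : finType) (d : K) := forall I : finType,
  exists A : pred {ffun I -> T}, d <= dens K A /\ ~ has_line A.

(** Densities are at most 1, so raising [d] in steps of [e] must stop. *)
Lemma line_free_dense_max (T : finType) (d e : K) : 0 < e -> line_free_dense T d ->
  exists2 d', d <= d' /\ line_free_dense T d' &
  exists D : finType, forall A : pred {ffun D -> T}, d' + e <= dens K A -> has_line A.
Proof.
move=> e0 bad_d.
have [j [bad_j good_j]] : exists j, line_free_dense T (d + e *+ j) /\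
    ~ line_free_dense T (d + e *+ j.+1).
  apply: contrapT => no.
  have bad_all j : line_free_dense T (d + e *+ j).
    elim: j => [|j IH]; first by rewrite mulr0n addr0.
    by apply: contrapT => good; apply: no; exists j.
  pose j := Num.bound (`|1 - d| / e).
  have : `|1 - d| / e < j%:R by apply: archi_boundP; rewrite divr_ge0 // ltW.
  rewrite ltr_pdivrMr // mulrC mulr_natr => hj.
  have [A [dA _]] := bad_all j void.
  have := dens_le1 K A; have := ler_norm (1 - d); lra.
exists (d + e *+ j); first by split=> //; rewrite lerDl mulrn_wge0 // ltW.
move: good_j => /existsNP[D] /forallNP hD; exists D => A dA.
by apply: contrapT => nA; apply: (hD A); rewrite mulrSr addrA.
Qed.

(** The slacks [d + e / #|X|%:R - f x] are nonnegative and sum to at most [e]. *)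
Lemma avg_lower (X : finType) (f : X -> K) (d e : K) : (0 < #|X|)%N ->
  (forall x, f x <= d + e / #|X|%:R) -> d <= avg f -> 0 <= e -> forall x, d - e <= f x.
Proof.
move=> X0 fd df e0 x.
have X0' : 0 < #|X|%:R :> K by rewrite ltr0n.
have h : \sum_x (d + e / #|X|%:R - f x) <= e.
  rewrite sumrB sumr_const -[X in X - _]mulr_natr mulrDl divfK ?lt0r_neq0 //.
  by move: df; rewrite /avg ler_pdivlMr //; lra.
have : d + e / #|X|%:R - f x <= e.
  apply: le_trans h; rewrite (bigD1 x) //= lerDl sumr_ge0 // => z _.
  by rewrite subr_ge0.
by have : 0 <= e / #|X|%:R by [rewrite divr_ge0 // ltW]; lra.
Qed.

Section Step.
Variable S : finType.

(** Letters of [S + Q] are constants or pointers into [w], so one random word over [S + Q] serves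
    every [w]. *)
Definition letter_sub (Q : finType) (w : {ffun Q -> option S}) (c : S + Q) : option S :=
  match c with inl s => Some s | inr q => w q end.

Definition some_word (Q : finType) (u : {ffun Q -> S}) : {ffun Q -> option S} :=
  [ffun q => Some (u q)].

Lemma some_lsub (Q : finType) (w : {ffun Q -> option S}) s :
  some_word (lsub w s) = fill s w.
Proof. by apply/ffunP=> q; rewrite !ffunE. Qed.

Lemma letter_sub_fill (J Q : finType) (w : {ffun Q -> option S}) s (l : {ffun J -> S + Q}) :
  [ffun i => letter_sub (fill s w) (l i)] = fill s [ffun i => letter_sub w (l i)].
Proof.
by apply/ffunP=> i; rewrite !ffunE /letter_sub; case: (l i) => // q; rewrite ffunE.
Qed.

(** With the [None] of [x] as wildcards, the letter [None] gives [x] itself and [s] gives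
    [fill s x]. *)
Lemma has_line_fill (I J : finType) (A : pred {ffun I + J -> option S})
    (x : {ffun I -> option S}) (y : {ffun J -> option S}) :
  (exists i, x i = None) -> A (catw x y) -> (forall s, A (catw (fill s x) y)) ->
  has_line A.
Proof.
move=> [i xi] Ax Afill.
exists (catw [ffun i => omap Some (x i)] [ffun j => Some (y j)]); split.
  by exists (inl i); rewrite !ffunE xi.
case=> [s|].
  congr (is_true (A _)): (Afill s).
  by apply/ffunP=> -[k|k]; rewrite !ffunE //=; case: (x k).
congr (is_true (A _)): Ax.
by apply/ffunP=> -[k|k]; rewrite !ffunE //=; case: (x k).
Qed.

Lemma DHJ_option : (0 < #|S|)%N -> DHJ K S -> DHJ K (optF S).
Proof.
move=> S0 dhj d0 d0_gt0; apply: contrapT => /forallNP no.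
have bad0 : line_free_dense (optF S) d0.
  move=> I; have /existsNP[A /not_implyP[]] := no I.
  by exists A.
have T0 : (0 < #|{: option S}|)%N by rewrite card_option.
have W0 (I : finType) : (0 < #|{ffun I -> option S}|)%N.
  by rewrite card_word_gt0 // card_option.
have d04 : 0 < d0 / 4 by lra.
have d01 : d0 <= 1 by have [A [dA _]] := bad0 void; exact: le_trans (dens_le1 K A).
have [Q hQ] := dhj _ d04.
pose ep : K := d0 / 4 / #|{ffun Q -> option S}|%:R.
have ep0 : 0 < ep by rewrite divr_gt0 ?ltr0n.
have ep1 : ep <= 1.
  rewrite /ep ler_pdivrMr ?ltr0n // mul1r.
  by have : 1 <= #|{ffun Q -> option S}|%:R :> K; [rewrite ler1n | lra].
(* [ep] will be a lower bound for the density of words with all substitutions in [A]; the final gain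
   [d1 * ep >= 4 * ga] beats three losses of [ga]. *)
pose ga := ep * d0 / 4.
have ga0 : 0 < ga by rewrite /ga; nra.
have ga1 : ga <= d0 / 4 by rewrite /ga; nra.
have [d1 [d01le bad1] [D hD]] := line_free_dense_max ga0 bad0.
have [N hN] := insens_boolean dhj D (enum S) S0 (ltac:(lra) : 0 < ga / 2).
have L0 : (0 < #|{: S + Q}|)%N by rewrite card_sum addn_gt0 S0.
have [J hJ] := free_template N T0 L0 (ltac:(lra) : 0 < ga / 2).
(* The block [Q] will carry the line [w] itself, which makes the wildcard [None]
   occur in every word. *)
pose M : finType := sumF J Q.
(* This second near-maximum, with tolerance adapted to [M], forces every section of [A] over [M] to
   have density at least [d2 - ga]. *)
have [|d2 [d12 bad2] [N2 hN2]] :=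
  @line_free_dense_max _ _ (ga / #|{ffun M -> option S}|%:R) _ bad1.
  by rewrite divr_gt0 ?ltr0n.
have [A [dA noA]] := bad2 (sumF M N2).
have dAx x : d2 - ga <= dens K (fun y => A (catw x y)).
  apply: (@avg_lower _ (fun z => dens K (fun y => A (catw z y))) _ _ (W0 _)) => [z||].
  - rewrite leNgt; apply/negP => /ltW /hN2 hl; apply: noA.
    apply: (has_line_app (full_inr z)).
    by congr has_line: hl; apply: funext => y; rewrite app_inr.
  - by rewrite -dens_catl.
  - exact: ltW.
pose sub w (l : {ffun J -> S + Q}) := [ffun i => letter_sub w (l i)].
(* All sections are dense, so the words [u] leading into [A] have average density at least
   [d2 - ga >= d0 / 2]; one line [w] then works for a proportion [ep] of the pairs. *)
have [||w [[q0 wq0] hw]] := @line_pigeonhole K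
    (prodF {ffun J -> S + Q} {ffun N2 -> option S}) Q S (d0 / 4)
    (fun ly u => A (catw (catw (sub (some_word u) ly.1) (some_word u)) ly.2)) _ d04 hQ.
- by rewrite card_prod muln_gt0 W0 card_word_gt0.
- rewrite avg_pair.
  apply: (@le_trans _ _ (avg (fun _ : {ffun J -> S + Q} => d2 - ga))).
    by rewrite avg_const ?card_word_gt0 //; lra.
  apply: ler_avg => l; rewrite avg_exchange.
  rewrite -[X in X <= _](avg_const (X := {ffun Q -> S})) ?card_word_gt0 //.
  by apply: ler_avg => u; have := dAx (catw (sub (some_word u) l) (some_word u)).
(* [E y s], membership in [A] after filling with [s], is insensitive. [A] misses the words with
   [Y y x = setT], so its excess [g] must show outside them. *)
pose E y s x := A (catw (catw (fill s x) (fill s w)) y).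
pose Y y x := [set s in enum S | E y s x].
pose a x y := A (catw (catw x w) y).
pose g y x : K := (a x y)%:R - (d1 + ga).
have aY x y : a x y -> Y y x = setT -> False.
  move=> axy YT; apply: noA; apply: (has_line_fill _ axy).
    by exists (inr q0); rewrite ffunE.
  move=> s; rewrite fill_catw.
  have : s \in Y y x by rewrite YT inE.
  by rewrite inE mem_enum.
have g1 y x : g y x <= 1.
  by rewrite /g; case: (a x y) => /=; lra.
(* [A] has density below [d1 + ga] on all subspaces of dimension [D], which bounds the excess
   outside the intersection of the [E y s]; [free_template] transfers this to random [sub w l]. *)
have upper y : avg (fun l => (Y y (sub w l) != setT)%:R * g y (sub w l)) <= ga / 2 + ga / 2.
  (* As [w q0 = None], the pointer to [q0] represents [None]. *)
  pose q (t : option S) : S + Q := if t is Some s then inl s else inr q0.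
  apply: (hJ (letter_sub w) q _ _ (fun x => (Y y x != setT)%:R * g y x)) => [||x|tau ft].
  - by case.
  - by lra.
  - by case: (_ != _); rewrite ?mul1r ?mul0r.
  apply: (hN (fun s u => E y s (app tau u)) _ (fun Z => Z != setT)
              (fun u => g y (app tau u))) => [s||sigma fs].
  - by apply: (@insens_app _ _ _ s (E y s)) => x; rewrite /E fillK.
  - by move=> u; apply: g1.
  rewrite avgD avg_const // subr_le0 leNgt; apply/negP => /ltW /hD hl; apply: noA.
  apply: (has_line_app (full_comp (full_inl y) (full_comp (full_inl w) (full_comp ft fs)))).
  by congr has_line: hl; apply: funext => v; rewrite !app_comp !app_inl.
have : avg (fun ly : {ffun J -> S + Q} * {ffun N2 -> option S} =>
    (Y ly.2 (sub w ly.1) != setT)%:R * g ly.2 (sub w ly.1)) <= ga.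
  rewrite avg_pair avg_exchange; apply: avg_le_const => // y.
  by apply: le_trans (upper y) _; lra.
apply/negP; rewrite -ltNge.
pose a' ly := a (sub w ly.1) ly.2.
pose h ly := Y ly.2 (sub w ly.1) == setT.
have ea : d1 - ga <= dens K a'.
  rewrite /dens avg_pair -[X in X <= _](avg_const (X := {ffun J -> S + Q})) ?card_word_gt0 //.
  by apply: ler_avg => l; apply: le_trans (dAx (catw (sub w l) w)); lra.
have eh : ep <= dens K h.
  apply: le_trans hw _; apply: ler_avg => -[l y]; rewrite ler_nat.
  case: forallP => //= Al; rewrite lt0b /h /Y; apply/eqP/setP => s.
  by rewrite !inE mem_enum /E -letter_sub_fill -some_lsub; apply: Al.
(* [a'] vanishes where [h] holds, so restricting to the complement of [h] only removes the term
   [d1 + ga] there. *)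
rewrite (eq_avg (g := fun ly => (a' ly)%:R + ((d1 + ga) * (h ly)%:R + - (d1 + ga)))); last first.
  move=> [l y]; rewrite /g /h -/(a' (l, y)) /=.
  case: eqP => [YT|_] /=; last by ring.
  case: (boolP (a' (l, y))) => [/aY/(_ YT)//|_] /=; ring.
rewrite !avgD avgZ avg_const -?/(dens K a') -?/(dens K h); last first.
  by rewrite card_prod muln_gt0 W0 card_word_gt0.
have : 4 * ga = ep * d0 by rewrite /ga; field.
by nra.
Qed.
End Step.
End Increment.

Section AllAlphabets.
Variable K : archiRealFieldType.

Lemma DHJ_unit : DHJ K unitF.
Proof.
move=> d d0; exists unitF => A dA.
have [|u du] := avg_ge_ex _ dA; first by rewrite card_word_gt0 ?card_unit.
exists [ffun=> None]; split=> [|[]]; first by exists tt; rewrite ffunE.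
rewrite (_ : lsub _ _ = u); first by case: (A u) du => // /(lt_le_trans d0); rewrite ltxx.
by apply/ffunP=> i; rewrite !ffunE; case: (u i).
Qed.

Lemma DHJ_bij (S T : finType) (f : S -> T) : bijective f -> DHJ K S -> DHJ K T.
Proof.
case=> g fK gK dhj d d0; have [I hI] := dhj d d0; exists I => A dA.
have [|w [[i wi] Aw]] := hI (fun u => A [ffun i => f (u i)]).
  apply: le_trans dA _; rewrite /dens.
  rewrite -(avg_bij (h := fun u : {ffun I -> S} => [ffun i => f (u i)] : {ffun I -> T})) //.
  exists (fun v : {ffun I -> T} => [ffun i => g (v i)] : {ffun I -> S}) => u;
  by apply/ffunP=> j; rewrite !ffunE ?fK ?gK.
exists [ffun i => omap f (w i)]; split=> [|t]; first by exists i; rewrite ffunE wi.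
congr (is_true (A _)): (Aw (g t)).
by apply/ffunP=> j; rewrite !ffunE; case: (w j) => //=; rewrite gK.
Qed.

Theorem density_hales_jewett (T : finType) : (0 < #|T|)%N -> DHJ K T.
Proof.
move=> T0; have [E [dhj cardE]] : exists E : finType, DHJ K E /\ #|E| = #|T|.
  rewrite -(prednK T0); elim: #|T|.-1 => [|m [E [dhj cardE]]].
    by exists unitF; rewrite card_unit; split; first exact: DHJ_unit.
  exists (optF E); rewrite card_option cardE; split=> //.
  by apply: DHJ_option => //; rewrite cardE.
by have [f bij_f] := bij_of_card cardE; apply: DHJ_bij bij_f dhj.
Qed.
End AllAlphabets.

(** * Chevalley-Warning and subspaces of zeros *)

Section MpolyDegree.
Variables (R : idomainType) (n : nat).
Implicit Types p q : {mpoly R[n]}.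

(** [msize] is the degree plus one, and 0 for the zero polynomial. *)
Lemma msize_mul p q a b : (msize p <= a.+1)%N -> (msize q <= b.+1)%N ->
  (msize (p * q) <= (a + b).+1)%N.
Proof.
move=> pa qb; have [->|p0] := eqVneq p 0; first by rewrite mul0r mmeasure0.
have [->|q0] := eqVneq q 0; first by rewrite mulr0 mmeasure0.
by rewrite msizeM //; lia.
Qed.

Lemma msize_prod (I : Type) (r : seq I) (F : I -> {mpoly R[n]}) (a : I -> nat) :
  (forall i, msize (F i) <= (a i).+1)%N ->
  (msize (\prod_(i <- r) F i) <= (\sum_(i <- r) a i).+1)%N.
Proof.
move=> Fa; elim: r => [|i r IH]; first by rewrite !big_nil msize1.
by rewrite !big_cons msize_mul.
Qed.

Lemma msize_exp p a k : (msize p <= a.+1)%N -> (msize (p ^+ k) <= (a * k).+1)%N.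
Proof.
move=> pa; elim: k => [|k IH]; first by rewrite expr0 msize1.
by rewrite exprS mulnS msize_mul.
Qed.

End MpolyDegree.

Section ChevalleyWarning.
Variable F : finFieldType.
Local Notation q := #|F|.

(** For [k > 0] some nonzero [a] has [a ^+ k != 1], as [X^k - 1] has at most [k] roots, and scaling
    by [a] multiplies the sum by [a ^+ k]. For [k = 0], shifting by 1 shows that [q] vanishes in
    [F]. *)
Lemma sum_power_eq0 k : (k < q.-1)%N -> \sum_(c : F) c ^+ k = 0.
Proof.
move=> kq.
have [->|k0] := posnP k.
  have : \sum_(c : F) (1 + c) = \sum_(c : F) c by rewrite [RHS](reindex_inj (addrI 1)).
  by rewrite big_split /= => /eqP; rewrite -subr_eq0 addrK => /eqP.
have [a a0 ak] : exists2 a : F, a != 0 & a ^+ k != 1.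
  apply/exists_inP; apply: contraLR kq => /exists_inPn all1; rewrite -leqNgt.
  rewrite -(cardC1 (0 : F)) cardE; apply: max_unity_roots => //; last exact: enum_uniq.
  apply/allP => a; rewrite mem_enum => /all1; rewrite negbK => /eqP ak.
  exact/unity_rootP.
have : (1 - a ^+ k) * \sum_(c : F) c ^+ k = 0.
  rewrite mulrBl mul1r mulr_sumr [X in X - _](reindex_inj (mulfI a0)) /=.
  by rewrite -sumrB big1 // => c _; rewrite exprMn subrr.
by move/eqP; rewrite mulf_eq0 subr_eq0 eq_sym (negbTE ak) => /eqP.
Qed.

(** In each monomial some variable has exponent below [q.-1], and its power sum vanishes. *)
Lemma sum_meval_eq0 n (p : {mpoly F[n]}) : (msize p <= n * q.-1)%N ->
  \sum_(v : {ffun 'I_n -> F}) p.@[v] = 0.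
Proof.
move=> hp; under eq_bigr do rewrite mevalE.
rewrite exchange_big big1_seq // => m /= /msize_mdeg_lt mp.
rewrite -mulr_sumr -(bigA_distr_bigA (fun i c => c ^+ m i)) /=.
have [i mi] : exists i, (m i < q.-1)%N.
  apply/existsP; apply: contraLR (leq_trans mp hp) => /existsPn ge.
  rewrite -leqNgt mdegE -{1}(card_ord n) -sum_nat_const leq_sum // => i _.
  by rewrite leqNgt.
by rewrite (bigD1 i) //= sum_power_eq0 // mul0r mulr0.
Qed.

(** [T] is the indicator of the common zeros, and its degree makes its values sum to 0; with the
    origin as only zero they would sum to 1. *)
Lemma chevalley_warning n d (J : finType) (Q : J -> {mpoly F[n]}) :
  (forall j, msize (Q j) <= d.+1)%N -> (#|J| * d < n)%N ->
  (forall j, (Q j).@[fun _ => 0] = 0) ->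
  exists2 v : {ffun 'I_n -> F}, v != [ffun=> 0] & forall j, (Q j).@[v] = 0.
Proof.
move=> Qd Jn Q0; have q1 : (0 < q.-1)%N.
  by rewrite -ltnS prednK ?finNzRing_gt1 // ltnW ?finNzRing_gt1.
pose T := \prod_j (1 - Q j ^+ q.-1).
have Tv v : T.@[v] = [forall j, (Q j).@[v] == 0]%:R.
  rewrite rmorph_prod /=; case: (boolP [forall j, _]) => [/forallP h|].
    rewrite big1 // => j _.
    by rewrite rmorphB rmorphXn rmorph1 /= (eqP (h j)) expr0n gtn_eqF // subr0.
  case/forallPn => j Qj; rewrite (bigD1 j) //= rmorphB rmorphXn rmorph1 /=.
  suff -> : (Q j).@[v] ^+ q.-1 = 1 by rewrite subrr mul0r.
  by apply: (mulfI Qj); rewrite mulr1 -exprS prednK ?expf_card // ltnW ?finNzRing_gt1.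
have size1B j : (msize (1 - Q j ^+ q.-1) <= (d * q.-1).+1)%N.
  apply: leq_trans (mmeasureD_le _ _ _) _; rewrite geq_max mmeasureN msize1 /=.
  exact: msize_exp.
have sizeT : (msize T <= n * q.-1)%N.
  apply: (@leq_trans (\sum_(j : J) (d * q.-1)).+1); first exact: msize_prod.
  by rewrite sum_nat_const mulnA ltn_mul2r q1.
have [/existsP[v /andP[v0 /forallP Qv]]|/existsPn none] :=
  boolP [exists v : {ffun 'I_n -> F}, (v != [ffun=> 0]) && [forall j, (Q j).@[v] == 0]].
  by exists v => // j; apply/eqP.
have := sum_meval_eq0 sizeT; rewrite (bigD1 [ffun=> 0]) //= big1 => [|v v0]; last first.
  by have := none v; rewrite v0 Tv /= => /negbTE ->.
rewrite Tv addr0 (_ : [forall j, _] = true) => [/eqP|]; first by rewrite oner_eq0.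
by apply/forallP => j; apply/eqP; rewrite -[RHS](Q0 j); apply: meval_eq => i; rewrite ffunE.
Qed.

End ChevalleyWarning.

(** * Subspaces on which homogeneous polynomials vanish *)

Section ZeroSubspace.
Variable F : finFieldType.

Lemma meval_homog n d (p : {mpoly F[n]}) (c : F) (v : 'I_n -> F) :
  p \is d.-homog -> p.@[fun i => c * v i] = c ^+ d * p.@[v].
Proof.
move=> /dhomogP hp; rewrite !mevalE mulr_sumr; apply: eq_big_seq => m /hp /= md.
rewrite mulrCA; congr (_ * _).
under eq_bigr do rewrite exprMn.
by rewrite big_split /= prodrXr -mdegE md.
Qed.

Lemma meval_subst n b d (p : {mpoly F[n]}) (l : 'I_n -> {mpoly F[b]}) :
  p \is d.-homog -> (forall t, msize (l t) <= 2)%N ->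
  exists2 r : {mpoly F[b]}, (msize r <= d.+1)%N &
    forall w : 'I_b -> F, r.@[w] = p.@[fun t => (l t).@[w]].
Proof.
move=> /dhomogP hp hl.
exists (\sum_(m <- msupp p) p@_m *: \prod_t l t ^+ m t).
  rewrite big_seq; elim/big_ind: _ => [|x y hx hy|m mp]; first by rewrite mmeasure0.
    by apply: leq_trans (mmeasureD_le _ _ _) _; rewrite geq_max hx.
  apply: leq_trans (msizeZ_le _ _) _.
  rewrite -(hp m mp) /= mdegE; apply: msize_prod => t.
  by rewrite -[X in (_ <= X.+1)%N]mul1n; apply: msize_exp.
move=> w; rewrite [RHS]mevalE rmorph_sum; apply: eq_bigr => m _ /=.
rewrite mevalZ rmorph_prod; congr (_ * _); apply: eq_bigr => t _.
by rewrite rmorphXn.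
Qed.

Section Spread.
Variables (n b : nat) (D : finType).
Hypothesis Db : (#|D| * b <= n)%N.

(** Matches the first [#|D| * b] coordinates with the pairs; the default [None] marks the others,
    where [spread] is 0. *)
Definition slot (t : 'I_n) : option (D * 'I_b) :=
  nth None [seq Some x | x <- enum {: D * 'I_b}] t.

Lemma slot_surj x : exists t, slot t = Some x.
Proof.
have xn : (index x (enum {: D * 'I_b}) < n)%N.
  apply: leq_trans Db; have <- : #|{: D * 'I_b}| = (#|D| * b)%N by rewrite card_prod card_ord.
  by rewrite cardE index_mem mem_enum.
exists (Ordinal xn); rewrite /slot (nth_map x) ?nth_index ?mem_enum //.
by rewrite index_mem mem_enum.
Qed.

(* The vectors [v k] occupy disjoint blocks of coordinates, so they are linearly
   independent as soon as they are nonzero. *)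
Definition spread (v : D -> {ffun 'I_b -> F}) (a : {ffun D -> F}) : 'rV[F]_n :=
  \row_t if slot t is Some ks then a ks.1 * v ks.1 ks.2 else 0.

Lemma spreadD v : {morph spread v : a a' / a + a'}.
Proof.
move=> a a'; apply/rowP=> t; rewrite !mxE; case: (slot t) => [ks|]; last by rewrite addr0.
by rewrite ffunE mulrDl.
Qed.

Lemma spread_eq0 v a : (forall k, v k != [ffun=> 0]) -> spread v a = 0 -> a = 0.
Proof.
move=> v0 /rowP sa; apply/ffunP=> k; rewrite ffunE.
have [s vks] : exists s, v k s != 0.
  apply/existsP; apply: contraNT (v0 k) => /existsPn vk.
  by apply/eqP/ffunP=> s; rewrite ffunE; apply/eqP; have := vk s; rewrite negbK.
have [t ht] := slot_surj (k, s).
by have /eqP := sa t; rewrite !mxE ht mulf_eq0 (negbTE vks) orbF => /eqP.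
Qed.

Variables (R d : nat) (P : 'I_R -> {mpoly F[n]}).
Hypotheses (d0 : (0 < d)%N) (Phom : forall j, P j \is d.-homog).
Hypothesis (bR : (#|{ffun D -> F}| * R * d < b)%N).

(* Adding one vector at a time: requiring [P j] to vanish on [a + w] for every
   [a] in the span of the previous vectors suffices, by homogeneity. *)
Lemma zero_span (r : seq D) : exists v : D -> {ffun 'I_b -> F},
  (forall k, (v k == [ffun=> 0]) = (k \notin r)) /\
  forall a j, (P j).@[spread v a 0] = 0.
Proof.
elim: r => [|k r [v [v0 Pv]]].
  exists (fun=> [ffun=> 0]); split=> [k|a j]; first by rewrite eqxx.
  rewrite (meval_eq (v2 := fun i => 0 * (0 : F))) => [|i].
    by rewrite (meval_homog _ _ (Phom j)) expr0n gtn_eqF // mul0r.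
  by rewrite mxE mul0r; case: (slot i) => // ks; rewrite ffunE mulr0.
have [kr|kr] := boolP (k \in r).
  exists v; split=> // k'; rewrite v0 inE negb_or.
  by have [->|//] := eqVneq k' k; rewrite kr.
have vk : v k = [ffun=> 0] by apply/eqP; rewrite v0.
pose upd (w : {ffun 'I_b -> F}) k' := if k' == k then w else v k'.
pose unit_k (a : {ffun D -> F}) : {ffun D -> F} := [ffun k' => if k' == k then 1 else a k'].
(* Coordinates when the [k]-th vector is unknown and has coefficient 1: degree at most 1 in that
   vector. *)
pose l (a : {ffun D -> F}) (t : 'I_n) : {mpoly F[b]} :=
  if slot t is Some ks then
    if ks.1 == k then 'X_ks.2 else (a ks.1 * v ks.1 ks.2)%:MP
  else 0.
have sl a t : (msize (l a t) <= 2)%N.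
  rewrite /l; case: (slot t) => [ks|]; last by rewrite mmeasure0.
  case: ifP => _; first by rewrite msizeX mdeg1.
  by rewrite mmeasureC; case: (_ != _).
have lE a (w : {ffun 'I_b -> F}) t : (l a t).@[w] = spread (upd w) (unit_k a) 0 t.
  rewrite mxE /l /upd; case: (slot t) => [ks|]; last by rewrite meval0.
  by rewrite ffunE; case: eqP => _; rewrite ?mevalXU ?mul1r ?mevalC.
have /fin_all_exists2[Q sQ QE] (aj : {ffun D -> F} * 'I_R) := meval_subst (Phom aj.2) (sl aj.1).
have spread0 (a : {ffun D -> F}) w : a k = 0 -> spread (upd w) a = spread v a.
  move=> ak; apply/rowP=> t; rewrite !mxE /upd; case: (slot t) => // ks.
  by case: eqP => [->|//]; rewrite ak !mul0r.
have [||w w0 Qw] := chevalley_warning sQ.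
- by rewrite card_prod card_ord.
- move=> [a j]; rewrite QE -[RHS](Pv (unit_k a) j); apply: meval_eq => t /=.
  rewrite (meval_eq (v2 := [ffun=> 0] : {ffun 'I_b -> F})) => [|s]; last by rewrite ffunE.
  rewrite lE !mxE; case: (slot t) => // ks.
  by rewrite /upd; case: eqP => [->|//]; rewrite vk.
exists (upd w); split=> [k'|a j].
  by rewrite /upd inE negb_or; have [_|_] := eqVneq k' k; rewrite ?(negbTE w0).
have [ak|ak] := eqVneq (a k) 0; first by rewrite spread0.
(* Dividing by [a k] reduces to coefficient 1 for the new vector, the case covered by the
   equations. *)
rewrite (meval_eq (v2 := fun t => a k * spread (upd w) (unit_k [ffun k' => (a k)^-1 * a k']) 0 t)).
  rewrite (meval_homog _ _ (Phom j)); apply/eqP; rewrite mulf_eq0; apply/orP; right.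
  have := Qw ([ffun k' => (a k)^-1 * a k'], j); rewrite QE => /eqP.
  by rewrite (meval_eq _ (lE _ w)).
move=> t; rewrite !mxE; case: (slot t) => [ks|]; last by rewrite mulr0.
rewrite !ffunE; case: eqP => [->|_]; first by rewrite mul1r.
by rewrite !mulrA divff // mul1r.
Qed.
End Spread.

Lemma zero_subspace n R d (D : finType) (P : 'I_R -> {mpoly F[n]}) :
  (0 < d)%N -> (forall j, P j \is d.-homog) ->
  (#|D| * (#|{ffun D -> F}| * R * d).+1 <= n)%N ->
  exists phi : {ffun D -> F} -> 'rV[F]_n,
    [/\ {morph phi : a a' / a + a'}, forall a, phi a = 0 -> a = 0 &
        forall a j, (P j).@[phi a 0] = 0].
Proof.
move=> d0 Phom Dn; have [v [v0 Pv]] := zero_span d0 Phom (leqnn _) (enum D).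
exists (spread n v); split=> //; first exact: spreadD.
by move=> a; apply: (spread_eq0 Dn) => k; rewrite v0 mem_enum.
Qed.
End ZeroSubspace.

(** * From combinatorial lines to arithmetic progressions *)

Theorem corollary1 (K : realType) (p d l : nat) (delta : K)
    (p_prime : prime p) (d_gt0 : (0 < d)%N) (d_lt_p : (d < p)%N)
    (delta_gt0 : 0 < delta) :
  exists2 c : K, 0 < c &
    forall (n R : nat) (A : {set 'rV['F_p]_n}) (P : 'I_R -> {mpoly 'F_p[n]}),
      (1 <= n)%N -> (1 <= R)%N ->
      density K A = delta ->
      (forall j : 'I_R, P j \is d.-homog) ->
      R%:R < c * n%:R ->
      exists x y : 'rV['F_p]_n,
        y \in (poly_map P @^-1: [set 0]) :\ 0 /\ arith_prog l x y \subset A.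
Proof.
have Fp0 : (0 < #|'F_p|)%N by rewrite card_Fp // prime_gt0.
have [D hD] := density_hales_jewett Fp0 delta_gt0.
(* As [R >= 1], [R * m < n] implies the bound on [n] required by [zero_subspace]. *)
pose m := (#|D|.+1 * (#|{ffun D -> 'F_p}| * d).+1)%N.
exists m%:R^-1; first by rewrite invr_gt0 ltr0n.
move=> n R A P n0 R0 dA Phom; rewrite mulrC ltr_pdivlMr ?ltr0n // -natrM ltr_nat => Rn.
have [|phi [phiD phi0 Pphi]] := @zero_subspace _ n R d D P d_gt0 Phom.
  apply: leq_trans (ltnW Rn); rewrite /m.
  have : (0 < R)%N by []. 
  move: #|D| #|{ffun D -> _}| => x y; nia.
have G0 : (0 < #|{: 'rV['F_p]_n}|)%N by apply/card_gt0P; exists 0.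
(* For fixed [a] the point [x + phi a] is uniform, so translates of the subspace meet [A] in density
   [delta] on average. *)
have [x0 hx0] : exists x0, delta <= dens K (fun a => x0 + phi a \in A).
  apply: avg_ge_ex => //; rewrite /dens avg_exchange -(avg_const delta (card_word_gt0 D Fp0)).
  apply: ler_avg => a.
  rewrite (avg_bij (fun x => (x \in A)%:R)); last first.
    by exists (fun x => x - phi a) => x; rewrite ?addrK ?subrK.
  rewrite -dA /density /avg card_mx mul1n card_Fp //.
  suff -> : #|A|%:R = \sum_x (x \in A)%:R :> K by [].
  by rewrite -sum1_card natr_sum big_mkcond; apply: eq_bigr => x _; case: ifP.
have [w [[k wk] Aw]] := hD _ hx0.
pose ind : {ffun D -> 'F_p} := [ffun k => (w k == None)%:R].
have phi00 : phi 0 = 0 by apply: (addrI (phi 0)); rewrite -phiD !addr0.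
have phiMn a i : phi (a *+ i) = phi a *+ i.
  by elim: i => [|i IH]; rewrite ?mulr0n // !mulrS phiD IH.
exists (x0 + phi (lsub w 0)), (phi ind); split.
  rewrite !inE; apply/andP; split.
    apply/eqP => /phi0/ffunP/(_ k); rewrite !ffunE wk eqxx /= => /eqP.
    by rewrite oner_eq0.
  by apply/eqP/rowP=> j; rewrite !mxE Pphi.
apply/subsetP => _ /imsetP[i _ ->].
(* The [i]-th term is the point of the line with letter [i] modulo [p], for every length [l]. *)
rewrite -addrA -phiMn -phiD (_ : _ + _ = lsub w i%:R); first exact: Aw.
apply/ffunP=> j; rewrite !(ffunE, ffunMnE); case: (w j) => [t|] /=.
  by rewrite mul0rn addr0.
by rewrite add0r.
Qed.
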